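(* Let $n\ge1$ be an integer and let $N$ be a generalized Waring process on $\mathbb R^d$ with parameters $a>0$, $\rho>n$, $k\in\mathbb N$ and parameter measure the Lebesgue measure on $\mathbb R^d$. Then $N$ is $n$th-order stationary: its $n$th-order moment measure $M_n(A_1\times\cdots\times A_n)=E[N(A_1)\cdots N(A_n)]$ is finite on products of bounded Borel sets and satisfies $M_n((A_1+u)\times\cdots\times(A_n+u))=M_n(A_1\times\cdots\times A_n)$ for all bounded Borel $A_1,\dots,A_n\subset\mathbb R^d$ and all $u\in\mathbb R^d$.
   Context: For $x>0$, $\beta\ge0$ write $x_{(\beta)}=\Gamma(x+\beta)/\Gamma(x)$, with $0_{(0)}=1$ and $0_{(n)}=0$ for integers $n\ge1$. For $a,\rho>0$ and $k_1,\dots,k_s\ge 0$, $\mathrm{MGWD}(a;k_1,\dots,k_s;\rho)$ denotes the law on $\{0,1,2,\dots\}^s$ with $P(X_i=x_i,\ i=1,\dots,s)=\frac{\rho_{(\sum_i k_i)}\,a_{(\sum_i x_i)}}{(\rho+a)_{(\sum_i k_i+\sum_i x_i)}}\prod_{i=1}^s\frac{(k_i)_{(x_i)}}{x_i!}$. A point process $N$ on a complete separable metric space $\mathcal S$ is a generalized Waring process with parameters $a,\rho,k>0$ and parameter measure $\mu$ (a boundedly finite Borel measure) if for every finite family of pairwise disjoint bounded Borel sets $A_1,\dots,A_l$, $(N(A_1),\dots,N(A_l))$ has the $\mathrm{MGWD}(a;k\mu(A_1),\dots,k\mu(A_l);\rho)$ distribution. *)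

(* Defs.v *)
From HB Require Import structures.
From mathcomp Require Import all_boot all_order all_algebra.
From mathcomp Require Import all_classical all_reals all_analysis measurable_realfun.
Set Implicit Arguments. Unset Strict Implicit. Unset Printing Implicit Defensive.
Import Order.TTheory GRing.Theory Num.Theory.
Import numFieldNormedType.Exports.
Local Open Scope classical_set_scope.
Local Open Scope ring_scope.

Definition Gamma (R : realType) (x : R) : R :=
  fine (\int[@lebesgue_measure R]_(t in `]0%R, +oo[) ((t `^ (x - 1)) * expR (- t))%:E)%E.

(* x_(beta) = Gamma(x+beta)/Gamma(x), with 0_(0) = 1 and 0_(beta) = 0 otherwise
   (the paper only uses 0_(n) for integers n). *)
Definition poch (R : realType) (x beta : R) : R :=
  if x == 0 then (beta == 0)%:R else Gamma (x + beta) / Gamma x.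

Definition mgwd_pmf (R : realType) (a rho : R) (s : nat) (kk : 'I_s -> R)
    (x : 'I_s -> nat) : R :=
  let K := \sum_(i < s) kk i in
  let X := (\sum_(i < s) x i)%N in
  poch rho K * poch a X%:R / poch (rho + a) (K + X%:R) *
  \prod_(i < s) (poch (kk i) (x i)%:R / (x i)`!%:R).

(* R^d is modelled as d.-tuple R, with the product (= Borel) sigma-algebra. *)
Definition bounded_rd (R : realType) (d : nat) (A : set (d.-tuple R)) : Prop :=
  exists M : R, forall x, A x -> forall i : 'I_d, `|tnth x i| <= M.

Definition box (R : realType) (d : nat) (a b : d.-tuple R) : set (d.-tuple R) :=
  [set x | forall i : 'I_d, tnth a i <= tnth x i <= tnth b i].

Definition box_vol (R : realType) (d : nat) (a b : d.-tuple R) : R :=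
  \prod_(i < d) Num.max (tnth b i - tnth a i) 0.

(* d-dimensional Lebesgue (outer) measure: infimum of total volumes of
   countable covers by boxes.  On Borel sets this is Lebesgue measure. *)
Definition lebesgue_d (R : realType) (d : nat) (A : set (d.-tuple R)) : \bar R :=
  ereal_inf [set s | exists (a b : nat -> d.-tuple R),
    A `<=` \bigcup_j box (a j) (b j) /\
    s = (\sum_(0 <= j <oo) (box_vol (a j) (b j))%:E)%E].

Definition translate (R : realType) (d : nat) (A : set (d.-tuple R))
    (u : d.-tuple R) : set (d.-tuple R) :=
  [set [tuple tnth x i + tnth u i | i < d] | x in A].

Definition point_process (R : realType) (dT : measure_display)
    (T : measurableType dT) (d : nat)
    (N : T -> {measure set (d.-tuple R) -> \bar R}) : Prop :=
  (forall w (A : set (d.-tuple R)), measurable A -> bounded_rd A ->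
     exists m : nat, N w A = (m%:R)%:E) /\
  (forall A : set (d.-tuple R), measurable A -> bounded_rd A ->
     measurable_fun [set: T] (fun w => N w A : \bar R)).

Definition gen_waring_process (R : realType) (dT : measure_display)
    (T : measurableType dT) (P : probability T R) (d : nat)
    (N : T -> {measure set (d.-tuple R) -> \bar R})
    (a rho k : R) (mu : set (d.-tuple R) -> \bar R) : Prop :=
  point_process N /\
  forall (l : nat) (A : 'I_l -> set (d.-tuple R)),
    (forall i, measurable (A i)) -> (forall i, bounded_rd (A i)) ->
    (forall i j, i != j -> A i `&` A j = set0) ->
    forall x : 'I_l -> nat,
      P [set w | forall i, N w (A i) = ((x i)%:R)%:E] =
      (mgwd_pmf a rho (fun i => k * fine (mu (A i))) x)%:E.

Definition moment (R : realType) (dT : measure_display)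
    (T : measurableType dT) (P : probability T R) (d : nat)
    (N : T -> {measure set (d.-tuple R) -> \bar R})
    (n : nat) (A : 'I_n -> set (d.-tuple R)) : \bar R :=
  (\int[P]_w (\prod_(i < n) fine (N w (A i)))%:E)%E.

(* Main.v *)
(** Translating the sets translates the atoms of the Boolean algebra they generate
    and preserves the Lebesgue measure of each atom, so the joint law of the counts
    on the atoms, hence every moment, is unchanged. Finiteness follows from
    [N(A_1) ... N(A_n) <= N(A_1 U ... U A_n)^n]: the count on one set has
    probabilities [p m] whose ratio [p (m+1) / p m] is
    [(a + m)(K + m) / ((rho + a + K + m)(m + 1))], by [Gamma (x+1) = x Gamma x],
    and for [rho > n] Raabe's test applies to [m^n p m]. *)

Require Import Defs.
From HB Require Import structures.
From mathcomp Require Import all_boot all_order all_algebra.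
From mathcomp Require Import all_classical all_reals all_analysis measurable_realfun.
From mathcomp Require Import ring.
Import Order.TTheory GRing.Theory Num.Theory.
Import numFieldNormedType.Exports.
Set Implicit Arguments. Unset Strict Implicit.
Local Open Scope classical_set_scope.
Local Open Scope ring_scope.

(** * Functional equation of the Gamma integral *)

(** With [b = n + 1], the bound [1 + y <= expR y] at [y = b / (x + 1)], raised to the power [x + 1],
    dominates the sequence by [(x + 1)^(x + 1) / b]. *)
Lemma powR_expRN_cvg0 (R : realType) (x : R) : 0 < x ->
  n.+1%:R `^ x * expR (- n.+1%:R) @[n --> \oo] --> (0 : R).
Proof.
move=> x0; have x1 : 0 < x + 1 by rewrite addr_gt0.
have Ccvg : (x + 1) `^ (x + 1) * harmonic n @[n --> \oo] --> (0 : R).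
  by rewrite -[X in _ --> X](mulr0 ((x + 1) `^ (x + 1))); apply: cvgMr; exact: cvg_harmonic.
apply: squeeze_cvgr (cvg_cst 0) Ccvg; apply: nearW => n; set b : R := n.+1%:R.
have b0 : 0 < b by rewrite /b ltr0n.
rewrite mulr_ge0 ?powR_ge0 ?expR_ge0//=.
rewrite -/b.
have bx : 0 < b / (x + 1) by rewrite divr_gt0.
have le_exp : (b / (x + 1)) `^ (x + 1) <= expR b.
  rewrite -[b in expR b](@divfK _ (x + 1)) ?gt_eqF// expRM.
  rewrite ge0_ler_powR ?nnegrE ?expR_ge0 ?(ltW x1) ?(ltW bx)//.
  by rewrite (le_trans _ (expR_ge1Dx _))// lerDr.
rewrite expRN ler_pdivrMr ?expR_gt0//.
apply: le_trans (ler_wpM2l _ le_exp); last first.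
  by rewrite mulr_ge0 ?powR_ge0 ?invr_ge0 ?(ltW b0).
rewrite powRM ?invr_ge0 ?(ltW b0) ?(ltW x1)//.
rewrite -[(x + 1)^-1]powR_inv1 ?(ltW x1)// -powRrM mulN1r powRN.
rewrite (@powRD _ b); last by rewrite gt_eqF// implybT.
rewrite powRr1 ?(ltW b0)//.
have c0 : (x + 1) `^ (x + 1) != 0 by rewrite gt_eqF// powR_gt0.
have bN0 := lt0r_neq0 b0.
set c := _ `^ _ in c0 *; set d := b `^ x.
clearbody b c d.
by rewrite le_eqVlt; apply/orP; left; apply/eqP; field; rewrite c0 bN0.
Qed.

Definition gamma_integrand (R : realType) (x t : R) : \bar R :=
  (t `^ (x - 1) * expR (- t))%:E.

Lemma gamma_integrand_ge0 (R : realType) (x t : R) : (0 <= gamma_integrand x t)%E.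
Proof. by rewrite lee_fin mulr_ge0 ?powR_ge0 ?expR_ge0. Qed.

Lemma measurable_gamma_integrand (R : realType) (D : set R) (x : R) :
  measurable_fun D (gamma_integrand x).
Proof.
apply/measurable_funTS/measurable_EFinP; apply: measurable_funM.
  exact: measurable_powR.
by apply: measurableT_comp => //; exact: measurable_expR.
Qed.

(** Integration by parts of [t^x] against [expR (- t)], on a compact interval away from 0, where
    powers of [t] are differentiable up to the endpoints. *)
Lemma gamma_integral_itv_parts (R : realType) (x e M : R) : 0 < x -> 0 < e < M ->
  (\int[@lebesgue_measure R]_(t in `[e, M]) gamma_integrand (x + 1) t =
   (e `^ x * expR (- e) - M `^ x * expR (- M))%:E +
   x%:E * \int[@lebesgue_measure R]_(t in `[e, M]) gamma_integrand x t)%E.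
Proof.
move=> x0 /andP[e0 eM].
have pos t : t \in `[e, M] -> 0 < t.
  by rewrite in_itv/= => /andP[/(lt_le_trans e0)].
have dF (p t : R) : 0 < t -> derivable (@powR R ^~ p) t 1.
  by move=> t0; apply: derivable_powR; rewrite in_itv/= t0.
have cF p : {within `[e, M], continuous (@powR R ^~ p)}.
  by apply: derivable_within_continuous => t /pos; exact: dF.
have dE (t : R) : derivable (fun s : R => expR (- s)) t 1 by [].
have cE : continuous (fun s : R => expR (- s)).
  by move=> t; apply/differentiable_continuous/derivable1_diffP.
have dLR (f : R -> R) : (forall t, 0 < t -> derivable f t 1) ->
    derivable_oo_LRcontinuous f e M.
  move=> df; have cf t : 0 < t -> {for t, continuous f}.
    by move=> t0; apply/differentiable_continuous/derivable1_diffP/df.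
  split.
  - by move=> t /[!in_itv]/= /andP[/(lt_trans e0) t0 _]; exact: df.
  - by apply: cvg_at_right_filter; exact: cf.
  - by apply: cvg_at_left_filter; apply: cf; exact: lt_trans eM.
have := @integration_by_parts R (@powR R ^~ x) (fun t => - expR (- t))
  (fun t => x * t `^ (x - 1)) (fun t => expR (- t)) e M eM.
rewrite /gamma_integrand addrK => ->; last 6 first.
- by move=> t; apply: cvgM; [exact: cvg_cst|exact: cF].
- by apply: dLR => t; exact: dF.
- by move=> t /[!in_itv]/= /andP[/(lt_trans e0) t0 _]; rewrite powR_derive1// in_itv/= t0.
- exact: continuous_subspaceT.
- by apply: dLR => t _; exact: derivableN.
- by move=> t _; rewrite derive1E derive_val mulrN1 opprK.
(* The sign is pulled out first, so that the factor [x] can then leave the integral of a nonnegative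
   function. *)
have -> : (\int[lebesgue_measure]_(t in `[e, M]) (x * t `^ (x - 1) * - expR (- t))%:E =
    - \int[lebesgue_measure]_(t in `[e, M]) (x%:E * gamma_integrand x t))%E.
  rewrite -integral_ge0N; last first.
    by move=> t _; rewrite mule_ge0 ?gamma_integrand_ge0// lee_fin ltW.
  by apply: eq_integral => t _; rewrite -EFinM -EFinN mulrN mulrA.
rewrite ge0_integralZl//=; last 3 first.
- exact: measurable_gamma_integrand.
- by move=> t _; exact: gamma_integrand_ge0.
- by rewrite lee_fin ltW.
by rewrite oppeK !mulrN opprK [X in X%:E]addrC.
Qed.

(** Passage to the limit along compact intervals exhausting the half-line: both integrals converge
    monotonically, and the boundary terms of the integration by parts tend to 0. *)
Lemma gamma_integralS (R : realType) (x : R) : 0 < x ->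
  (\int[@lebesgue_measure R]_(t in `]0%R, +oo[) gamma_integrand (x + 1) t =
   x%:E * \int[@lebesgue_measure R]_(t in `]0%R, +oo[) gamma_integrand x t)%E.
Proof.
(* [n.+2] on the left keeps the interval nondegenerate at [n = 0], where it is [[1/2, 1]]. *)
move=> x0; pose F (n : nat) : set R := `[(n.+2%:R)^-1, n.+1%:R]%classic.
have ltF (n : nat) : 0 < (n.+2%:R^-1 : R) < n.+1%:R.
  rewrite invr_gt0 ltr0n/=; apply: (@lt_le_trans _ _ 1); last by rewrite ler1n.
  by rewrite invf_lt1 ?ltr1n ?ltr0n.
have UF : \bigcup_n F n = `]0%R, +oo[%classic.
  apply/seteqP; split => t /=.
    move=> [n _]; rewrite /F/= !in_itv/= andbT => /andP[+ _].
    by apply: lt_le_trans; case/andP: (ltF n).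
  rewrite in_itv/= andbT => t0.
  exists (maxn (Num.truncn t) (Num.truncn t^-1)) => //.
  rewrite /F/= in_itv/=; apply/andP; split.
    rewrite invf_ple ?posrE ?ltr0n// ltW// (lt_le_trans (truncnS_gt _))//.
    by rewrite ler_nat ltnS leqW// leq_maxr.
  by rewrite ltW// (lt_le_trans (truncnS_gt _))// ler_nat ltnS leq_maxl.
have ndF : nondecreasing_seq F.
  apply/nondecreasing_seqP => n; apply/subsetPset/subset_itv; rewrite bnd_simp.
    by rewrite lef_pV2 ?posrE ?ltr0n// ler_nat.
  by rewrite ler_nat.
have cvgF (y : R) : (\int[@lebesgue_measure R]_(t in F n) gamma_integrand y t
    @[n --> \oo] --> \int[@lebesgue_measure R]_(t in `]0%R, +oo[) gamma_integrand y t)%E.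
  rewrite -UF; apply: ge0_nondecreasing_set_cvg_integral => //.
  - by move=> n; exact: measurable_itv.
  - by move=> n; exact: measurable_gamma_integrand.
  - by move=> n t _; exact: gamma_integrand_ge0.
have bd0 : (n.+2%:R)^-1 `^ x * expR (- (n.+2%:R)^-1) -
    n.+1%:R `^ x * expR (- n.+1%:R) @[n --> \oo] --> (0 : R).
  rewrite -[X in _ --> X]subr0; apply: cvgB; last exact: powR_expRN_cvg0.
  have cvgi : (n.+2%:R)^-1 `^ x @[n --> \oo] --> (0 : R).
    have /cvg_at_rightP := powR_cvg0 x0; apply; split.
      by move=> n; case/andP: (ltF n).
    have := @cvg_harmonic R; rewrite -(cvg_shiftS (harmonic : R ^nat)).
    exact.
  apply: squeeze_cvgr (cvg_cst 0) cvgi; apply: nearW => n.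
  by rewrite mulr_ge0 ?powR_ge0 ?expR_ge0//= ler_piMr ?powR_ge0.
have := cvg_unique (@ereal_hausdorff R) (cvgF (x + 1)); apply => /=.
rewrite -[X in _ --> X]add0e.
under eq_fun do rewrite (gamma_integral_itv_parts x0 (ltF _)).
apply: cvgeD => //; first by apply: cvg_EFin; [exact: nearW|exact: bd0].
by apply: cvgeZl => //; exact: cvgF.
Qed.

(* Integrability is not needed: were the integrals infinite, [fine] would send both
   sides to 0. *)
Lemma Gamma_add1 (R : realType) (x : R) : 0 < x -> Gamma (x + 1) = x * Gamma x.
Proof.
move=> x0; rewrite /Gamma; have := gamma_integralS x0.
rewrite /gamma_integrand => ->.
set I := integral _ _ _; case: I => [r| |] //=.
- by rewrite gt0_muley ?lte_fin//= mulr0.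
- by rewrite gt0_muleNy ?lte_fin//= mulr0.
Qed.

(** * Pochhammer symbols and the law of a single count *)

Lemma poch_add1 (R : realType) (x b : R) : x != 0 -> 0 < x + b ->
  poch x (b + 1) = (x + b) * poch x b.
Proof. by move=> xN0 xb; rewrite /poch (negbTE xN0) addrA Gamma_add1// mulrA. Qed.

(** The case [x = 0] is included because null sets have parameter 0. There the left side is 0, and
    so is the right: through its first factor at [m = 0], through [poch 0 m] otherwise. *)
Lemma poch_natS (R : realType) (x : R) (m : nat) : 0 <= x ->
  poch x m.+1%:R = (x + m%:R) * poch x m%:R.
Proof.
rewrite -natr1 le_eqVlt => /predU1P[<-|x0]; last first.
  by rewrite poch_add1 ?gt_eqF// ltr_wpDr.
rewrite /poch eqxx add0r natr1 !pnatr_eq0.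
by case: m => [|m]; rewrite ?mul0r ?mulr0.
Qed.

(** The univariate generalized Waring (beta negative binomial) law, kept as a one-coordinate
    [mgwd_pmf] so that the law of a single count applies as it stands. *)
Definition waring_pmf (R : realType) (a rho K : R) (m : nat) : R :=
  mgwd_pmf a rho (fun _ : 'I_1 => K) (fun=> m).

(** The ratio of consecutive probabilities is cleared of denominators, since they may vanish, for
    instance when [K = 0] and [m > 0]. *)
Lemma waring_pmfS (R : realType) (a rho K : R) (m : nat) :
  0 < a -> 0 < rho -> 0 <= K ->
  (rho + a + K + m%:R) * m.+1%:R * waring_pmf a rho K m.+1 =
  (a + m%:R) * (K + m%:R) * waring_pmf a rho K m.
Proof.
move=> a0 rho0 K0; rewrite /waring_pmf /mgwd_pmf !big_ord1.
have ra0 : 0 < rho + a by rewrite addr_gt0.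
rewrite !poch_natS ?(ltW a0)// (_ : K + m.+1%:R = K + m%:R + 1); last by rewrite -natr1 addrA.
rewrite poch_add1 ?gt_eqF//; last first.
  by rewrite !addrA -addrA ltr_wpDr ?addr_ge0.
have mS0 : m.+1%:R != 0 :> R by rewrite pnatr_eq0.
have c0 : rho + a + K + m%:R != 0 by rewrite gt_eqF// -addrA ltr_wpDr ?addr_ge0.
rewrite !addrA factS natrM !invfM.
(* With these inverses named, [field] treats them as variables and only asks that [s] and [t] be
   nonzero. *)
set d := (poch _ _)^-1; set e := (_`!%:R)^-1.
rewrite [_^-1 * d]mulrC.
set A := poch a _; set B := poch K _; set C := poch rho _.
set s := rho + a + K + m%:R in c0 *; set t := m.+1%:R in mS0 *.
clearbody A B C d e s t.
by field; rewrite c0 mS0.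
Qed.

(** * Moments of order below [rho], by Raabe's test *)

Section rising_moments.
Context {R : realType} (a rho K : R) (n : nat) (p : nat -> R).
Hypotheses (a0 : 0 < a) (K0 : 0 <= K) (nrho : n%:R < rho).
Hypothesis p0 : forall m, 0 <= p m.
Hypothesis pS : forall m, (rho + a + K + m%:R) * m.+1%:R * p m.+1 =
  (a + m%:R) * (K + m%:R) * p m.

(* The rising factorial [m (m+1) ... (m+n-1)] dominates [m^n] and has a rational
   ratio of consecutive terms. *)
Let v (m : nat) : R := (\prod_(j < n) (m + j)%:R) * p m.
(* Chosen so that [S m - S m.+1 = (rho - n + o(1)) * v m], which makes the series of
   the [v m] telescope; [delta] below absorbs the [o(1)]. *)
Let S (m : nat) : R := (rho + a + K + m%:R - 1) * v m.
Let delta : R := (rho - n%:R) / 2.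

Let delta0 : 0 < delta. Proof. by rewrite divr_gt0// subr_gt0. Qed.

Let v_ge0 m : 0 <= v m.
Proof. by rewrite mulr_ge0// prodr_ge0. Qed.

Let rho0 : 0 < rho. Proof. exact: le_lt_trans nrho. Qed.

(** The [- 1] in [S] turns the first factor of [S m.+1] into [rho + a + K + m], the one that [pS]
    can absorb; multiplying by [m] shifts the rising factorial. *)
Let S_succ m : m%:R * m.+1%:R * S m.+1 =
  (m + n)%:R * (a + m%:R) * (K + m%:R) * v m.
Proof.
have shift : m%:R * \prod_(j < n) (m.+1 + j)%:R = (m + n)%:R * \prod_(j < n) (m + j)%:R :> R.
  have -> : m%:R * \prod_(j < n) (m.+1 + j)%:R = \prod_(j < n.+1) (m + j)%:R :> R.
    rewrite big_ord_recl addn0; congr (_ * _); apply: eq_bigr => j _.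
    by rewrite lift0 addSnnS.
  by rewrite big_ord_recr mulrC.
rewrite /S /v -[in X in _ + X - 1]natr1 addrA addrK.
rewrite [LHS](_ : _ = (m%:R * \prod_(j < n) (m.+1 + j)%:R) *
  ((rho + a + K + m%:R) * m.+1%:R * p m.+1)); last by ring.
by rewrite shift pS; ring.
Qed.

Let descent : exists m0 : nat, forall m, (m0 <= m)%N -> (0 < m)%N /\
  delta * v m <= S m - S m.+1.
Proof.
(* In [key] below, the cubic terms cancel and the quadratic terms differ by [delta * y ^ 2]. [D]
   collects the negative contributions of lower degree, the constant one being absorbed through
   [1 <= y]. *)
pose N : R := n%:R; pose D : R := 1 + N * K + N * a + a * K + N * a * K.
have N0 : 0 <= N by rewrite ler0n.
(* The successor makes the threshold exceed [D / delta] and also forces [0 < m]. *)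
exists (Num.truncn (D / delta)).+1 => m m0m; split; first exact: leq_ltn_trans m0m.
set y : R := m%:R.
have y1 : 1 <= y by rewrite ler1n; exact: leq_ltn_trans m0m.
have y0 : 0 < y by exact: lt_le_trans y1.
have Dy : D <= delta * y.
  rewrite mulrC -ler_pdivrMr// ltW// (lt_le_trans (truncnS_gt _))//.
  by rewrite ler_nat.
have key : (y + N) * (a + y) * (K + y) <= y * (y + 1) * (rho + a + K + y - 1 - delta).
  rewrite -subr_ge0.
  have rhoE : rho = N + 2 * delta by rewrite /delta /N; field.
  rewrite [X in 0 <= X](_ : _ = y * (delta * y - D) + N * a * K * (y - 1) +
    y * (N + delta + a + K)); last by rewrite /D rhoE; ring.
  have a0' := ltW a0; have d0' := ltW delta0.
  rewrite !addr_ge0// ?mulr_ge0 ?subr_ge0 ?(ltW y0)//.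
  by rewrite !addr_ge0.
have yy0 : 0 < y * (y + 1) by rewrite mulr_gt0// addr_gt0.
have SE : S m.+1 = (y + N) * (a + y) * (K + y) / (y * (y + 1)) * v m.
  have := S_succ m; rewrite -natr1 natrD -/y -/N => SS.
  by rewrite mulrAC -SS mulrAC divff ?mul1r// gt_eqF.
rewrite SE -mulrBl ler_wpM2r// lerBrDr addrC -lerBrDr ler_pdivrMr//.
by rewrite [X in _ <= X]mulrC.
Qed.

(** By [descent], [delta] times the partial sum of [v] plus the current value of [S] does not
    increase past [m0], so its value at [m0] is a bound. *)
Lemma rising_moment_bounded : exists B : R, forall M,
  \sum_(m < M) m%:R ^+ n * p m <= B.
Proof.
have [m0 desc] := descent.
pose B := delta * (\sum_(m < m0) v m) + S m0.
have tele i : delta * (\sum_(m < m0 + i) v m) + S (m0 + i)%N <= B.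
  elim: i => [|i IH]; first by rewrite addn0.
  apply: le_trans IH; rewrite addnS big_ord_recr/= mulrDr -addrA lerD2l.
  by rewrite -lerBrDr; have [] := desc _ (leq_addr i m0).
have le_v m : m%:R ^+ n * p m <= v m.
  rewrite ler_wpM2r// -[n in _ ^+ n]card_ord -prodr_const ler_prod// => j _.
  by rewrite ler0n ler_nat leq_addr.
exists (B / delta) => M; rewrite ler_pdivlMr// mulrC.
(* The sum up to [M] is compared with the one up to [m0 + M]; this index is positive, which makes
   [S] nonnegative there despite its [- 1]. *)
apply: le_trans (tele M); rewrite -[X in X <= _]addr0 lerD//; last first.
  have [m_gt0 _] := desc _ (leq_addr M m0).
  rewrite mulr_ge0// -addrA addr_ge0 ?subr_ge0 ?ler1n//.
  by rewrite !addr_ge0// ltW.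
rewrite ler_wpM2l ?(ltW delta0)//.
apply: (@le_trans _ _ (\sum_(m < M) v m)); first by apply: ler_sum.
rewrite -!(big_mkord predT v) [X in _ <= X](@big_cat_nat _ _ _ M)//= ?leq_addl//.
by rewrite lerDl sumr_ge0.
Qed.

End rising_moments.

(** * Integrals of functions of countably valued maps *)

Section countable_law.
Context {R : realType} {dT : measure_display} {T : measurableType dT}.
Variable P : {measure set T -> \bar R}.
Local Open Scope ereal_scope.

Lemma measurable_fibers (Z : T -> nat) (g : nat -> \bar R) :
  (forall m, measurable [set w | Z w = m]) -> measurable_fun [set: T] (g \o Z).
Proof.
move=> mZ _ Y mY; rewrite setTI.
rewrite (_ : _ @^-1` _ = \bigcup_(m in [set m | Y (g m)]) [set w | Z w = m]).
  by apply: bigcup_measurable => m _; exact: mZ.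
by apply/seteqP; split => [w Yw|w [m Ym /= Zw]]; [exists (Z w)|rewrite /= Zw].
Qed.

Lemma ge0_integral_fibers (Z : T -> nat) (g : nat -> \bar R) :
  (forall m, 0 <= g m) -> (forall m, measurable [set w | Z w = m]) ->
  \int[P]_w g (Z w) = \sum_(m <oo) g m * P [set w | Z w = m].
Proof.
move=> g0 mZ.
have TE : [set: T] = \bigcup_m [set w | Z w = m].
  by apply/seteqP; split => [w _|//]; exists (Z w).
rewrite [in LHS]TE ge0_integral_bigcup => [|//||w _|]; last 3 first.
- by rewrite -TE; exact: measurable_fibers.
- exact: g0.
- by move=> i j _ _ [w [/= <- <-]].
apply: eq_eseriesr => m _; rewrite -integral_cst//.
by apply: eq_integral => w /[!inE]/= ->.
Qed.

(** Encoding [C] into [nat] turns both integrals into series over fibers, which agree term by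
    term. *)
Lemma ge0_integral_eq_law (C : countType) (Y Y' : T -> C) (f : C -> \bar R) :
  (forall c, 0 <= f c) ->
  (forall c, measurable [set w | Y w = c]) ->
  (forall c, measurable [set w | Y' w = c]) ->
  (forall c, P [set w | Y w = c] = P [set w | Y' w = c]) ->
  \int[P]_w f (Y w) = \int[P]_w f (Y' w).
Proof.
move=> f0 mY mY' PYY'.
(* The default 0 is harmless: [g] is only evaluated at codes, and the other fibers are empty. *)
pose g m := if @unpickle C m is Some c then f c else 0.
have g0 m : 0 <= g m by rewrite /g; case: unpickle.
(* [pickle_inv] replaces [unpickle] here because [unpickle m = Some c] does not imply
   [pickle c = m]. *)
have fibE (Z : T -> C) m : [set w | pickle (Z w) = m] =
    if @pickle_inv C m is Some c then [set w | Z w = c] else set0.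
  case E : (pickle_inv m) => [c|].
    have := @pickle_invK C m; rewrite E /= => <-.
    by apply/seteqP; split => w /=; [exact: pcan_inj pickleK _ _|move=> ->].
  by apply/seteqP; split => w //= Zm; move: E; rewrite -Zm pickleK_inv.
have fE Z : \int[P]_w f (Z w) = \int[P]_w g (pickle (Z w)).
  by apply: eq_integral => w _; rewrite /g pickleK.
have mfib (Z : T -> C) : (forall c, measurable [set w | Z w = c]) ->
    forall m, measurable [set w | pickle (Z w) = m].
  by move=> mZ m; rewrite fibE; case: pickle_inv.
rewrite !fE !ge0_integral_fibers//; [|exact: mfib..].
by apply: eq_eseriesr => m _; rewrite !fibE; case: pickle_inv => [c|//]; rewrite PYY'.
Qed.

End countable_law.

(** * Atoms of the Boolean algebra generated by a finite family *)

(** The first clause empties the atom of [J = set0], which would otherwise be the complement of the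
    union, possibly unbounded and so outside the reach of the process. *)
Definition atom {X : Type} {n : nat} (A : 'I_n -> set X) (J : {set 'I_n}) : set X :=
  [set x | (exists i, A i x) /\ forall i, A i x <-> i \in J].

Section atoms.
Context {X : Type} {n : nat} (A : 'I_n -> set X).

Lemma atom_disjoint (J J' : {set 'I_n}) : J != J' -> atom A J `&` atom A J' = set0.
Proof.
move=> /eqP JJ'; rewrite -subset0 => x [[_ xJ] [_ xJ']]; apply: JJ'.
by apply/setP => i; apply/idP/idP => [/xJ/xJ'|/xJ'/xJ].
Qed.

Lemma bigcup_atom (i : 'I_n) : A i = \bigcup_(J in [set J : {set 'I_n} | i \in J]) atom A J.
Proof.
apply/seteqP; split => [x Aix|x [J /= iJ [_ xJ]]]; last exact/xJ.
pose J := [set j | `[< A j x >]]%SET.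
have JE j : A j x <-> j \in J by rewrite inE asboolE.
by exists J; [exact/JE|split; [exists i|]].
Qed.

Lemma atom_subset (J : {set 'I_n}) : atom A J `<=` \bigcup_i A i.
Proof. by move=> x [[i Aix] _]; exists i. Qed.

End atoms.

Lemma measurable_atom {d} {X : measurableType d} {n : nat} (A : 'I_n -> set X)
  (J : {set 'I_n}) : (forall i, measurable (A i)) -> measurable (atom A J).
Proof.
move=> mA.
rewrite (_ : atom A J = (\bigcup_i A i) `&`
    \bigcap_i (if i \in J then A i else ~` A i)).
  apply: measurableI; first by apply: fin_bigcup_measurable => // i _; exact: mA.
  apply: fin_bigcap_measurable => // i _; case: ifP => _ //.
  exact: measurableC.
apply/seteqP; split => x /=.
  move=> [[i Aix] xJ]; split; first by exists i.
  by move=> j _; case: ifPn => [/xJ//|/negP jJ /xJ].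
move=> [[i _ Aix] xJ]; split; first by exists i.
by move=> j; have := xJ j I; case: ifP => [jJ Ajx|jJ Ajx]; split.
Qed.

Lemma measure_sum_atoms {d} {X : measurableType d} {R : realType} {n : nat}
    (mu : {measure set X -> \bar R}) (A : 'I_n -> set X) (i : 'I_n) :
  (forall i, measurable (A i)) ->
  mu (A i) = (\sum_(J : {set 'I_n} | i \in J) mu (atom A J))%E.
Proof.
move=> mA; rewrite {1}(bigcup_atom A i) measure_fin_bigcup; last 3 first.
- exact: finite_finset.
- by apply/trivIsetP => J J' _ _; exact: atom_disjoint.
- by move=> J _; exact: measurable_atom.
rewrite -(@bigfs _ _ _ _ (index_enum _)) ?index_enum_uniq// => J _.
by rewrite mem_index_enum.
Qed.

(** * Translations of Euclidean space and Lebesgue measure *)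

Section euclidean.
Context {R : realType} {d : nat}.
Implicit Types (A : set (d.-tuple R)) (u x : d.-tuple R).

Definition shift u x : d.-tuple R := [tuple tnth x i + tnth u i | i < d].
Definition oppt u : d.-tuple R := [tuple - tnth u i | i < d].

Lemma shiftK u : cancel (shift u) (shift (oppt u)).
Proof. by move=> x; apply: eq_from_tnth => i; rewrite !tnth_mktuple addrK. Qed.

Lemma shiftNK u : cancel (shift (oppt u)) (shift u).
Proof. by move=> x; apply: eq_from_tnth => i; rewrite !tnth_mktuple subrK. Qed.

(** Seen as a preimage under the opposite shift, a translate inherits measurability and commutes
    with Boolean operations. *)
Lemma translateE A u : translate A u = shift (oppt u) @^-1` A.
Proof.
apply/seteqP; split => [x [y Ay <-]|x Ax] /=; first by rewrite -/(shift u y) shiftK.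
by exists (shift (oppt u) x) => //; exact: shiftNK.
Qed.

Lemma measurable_shift u : measurable_fun [set: d.-tuple R] (shift u).
Proof.
apply/measurable_fun_tnthP => i.
rewrite (_ : _ \o _ = fun x => tnth x i + tnth u i); last first.
  by apply/funext => x /=; rewrite tnth_mktuple.
by apply: measurable_funD => //; exact: measurable_tnth.
Qed.

Lemma measurable_translate A u : measurable A -> measurable (translate A u).
Proof. by move=> mA; rewrite translateE -[X in measurable X]setTI; exact: measurable_shift. Qed.

Lemma bounded_translate A u : bounded_rd A -> bounded_rd (translate A u).
Proof.
(* The sum bounds all coordinates of [u] at once. *)
move=> [M AM]; exists (M + \sum_i `|tnth u i|) => _ [y Ay <-] i.
rewrite tnth_mktuple (le_trans (ler_normD _ _))// lerD ?AM//.
by rewrite (bigD1 i)//= lerDl sumr_ge0.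
Qed.

Lemma bounded_sub A B : A `<=` B -> bounded_rd B -> bounded_rd A.
Proof. by move=> AB [M BM]; exists M => x /AB; exact: BM. Qed.

Lemma bounded_bigcup n (A : 'I_n -> set (d.-tuple R)) :
  (forall i, bounded_rd (A i)) -> bounded_rd (\bigcup_i A i).
Proof.
move=> bA; have [M AM] := choice bA.
exists (\sum_i `|M i|) => x [i _ Aix] j; rewrite (le_trans (AM i x Aix j))//.
by rewrite (bigD1 i)//= (le_trans (ler_norm _))// lerDl sumr_ge0.
Qed.

Lemma lebesgue_d_ge0 A : (0 <= lebesgue_d A)%E.
Proof.
apply: le_ereal_inf_tmp => _ [a [b [_ ->]]]; apply: nneseries_ge0 => j _ _.
by rewrite lee_fin prodr_ge0// => i _; rewrite le_max lexx orbT.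
Qed.

(** Translating a cover by boxes yields a cover of the translate with the same side lengths. *)
Lemma lebesgue_d_translate_le A u : (lebesgue_d (translate A u) <= lebesgue_d A)%E.
Proof.
apply: ereal_inf_le_tmp => _ [a [b [Aab ->]]].
exists (shift u \o a), (shift u \o b); split.
  move=> _ [y /Aab[j _ yj] <-]; exists j => // i.
  by rewrite !tnth_mktuple !lerD2r.
apply: eq_eseriesr => j _; congr (_%:E); apply: eq_bigr => i _.
by rewrite !tnth_mktuple opprD addrACA subrr addr0.
Qed.

Lemma lebesgue_d_translate A u : lebesgue_d (translate A u) = lebesgue_d A.
Proof.
apply/le_anti; rewrite lebesgue_d_translate_le/=.
(* The reverse inequality is the previous lemma applied to the translate and the opposite vector. *)
have {1}-> : A = translate (translate A u) (oppt u).
  by rewrite !translateE; apply/seteqP; split => x /=; rewrite shiftNK.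
exact: lebesgue_d_translate_le.
Qed.

Lemma atom_translate n (A : 'I_n -> set (d.-tuple R)) u (J : {set 'I_n}) :
  atom (fun i => translate (A i) u) J = translate (atom A J) u.
Proof. by rewrite translateE; under eq_fun do rewrite translateE. Qed.

End euclidean.

(** * Counts on atoms and moments of the process *)

Section waring_process.
Context {R : realType} {dT : measure_display} {T : measurableType dT}.
Context {P : probability T R} {d : nat}.
Context {N : T -> {measure set (d.-tuple R) -> \bar R}}.
Implicit Types A : set (d.-tuple R).

(** Natural-valued, so that the results on countable laws apply; [cntE] recovers [N w A] on bounded
    Borel sets. *)
Definition cnt w A : nat := Num.truncn (fine (N w A)).

Hypothesis ppN : point_process N.

Lemma cntE w A : measurable A -> bounded_rd A -> N w A = (cnt w A)%:R%:E.
Proof. by move=> mA bA; have [m Nm] := ppN.1 w A mA bA; rewrite /cnt Nm natrK. Qed.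

Lemma cnt_eqP w A m : measurable A -> bounded_rd A ->
  cnt w A = m <-> N w A = m%:R%:E.
Proof.
move=> mA bA; rewrite (cntE w mA bA); split => [->//|[/eqP]].
by rewrite eqr_nat => /eqP.
Qed.

Lemma measurable_count_eq A m : measurable A -> bounded_rd A ->
  measurable [set w | cnt w A = m].
Proof.
move=> mA bA; rewrite (_ : mkset _ = [set: T] `&` (fun w => N w A) @^-1` [set m%:R%:E]).
  by apply: (ppN.2 A mA bA) => //; exact: emeasurable_set1.
by rewrite setTI; apply/seteqP; split => w /= /cnt_eqP; apply.
Qed.

(** A finitely supported index makes this a map into a countable type, as [ge0_integral_eq_law]
    requires. *)
Definition atom_counts n (A : 'I_n -> set (d.-tuple R)) w : {ffun {set 'I_n} -> nat} :=
  [ffun J => cnt w (atom A J)].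

Definition atom_product n (y : {ffun {set 'I_n} -> nat}) : R :=
  \prod_(i < n) \sum_(J : {set 'I_n} | i \in J) (y J)%:R.

Section bounded_borel_family.
Variables (n : nat) (A : 'I_n -> set (d.-tuple R)).
Hypotheses (mA : forall i, measurable (A i)) (bA : forall i, bounded_rd (A i)).

Lemma bounded_atom J : bounded_rd (atom A J).
Proof. exact: bounded_sub (@atom_subset _ _ A J) (bounded_bigcup bA). Qed.

(** Each [A i] is the disjoint union of the atoms with [i \in J], so the product of the counts is a
    function of the atom counts alone. *)
Lemma moment_atoms : moment P N A = (\int[P]_w (atom_product (atom_counts A w))%:E)%E.
Proof.
apply: eq_integral => w _; congr (_%:E); apply: eq_bigr => i _.
rewrite (measure_sum_atoms (N w) i mA).
have NE J : N w (atom A J) = (cnt w (atom A J))%:R%:E.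
  by apply: cntE; [exact: measurable_atom|exact: bounded_atom].
under eq_bigr do rewrite NE.
by rewrite sumEFin/=; apply: eq_bigr => J _; rewrite ffunE.
Qed.

Lemma measurable_atom_counts y : measurable [set w | atom_counts A w = y].
Proof.
rewrite (_ : mkset _ = \bigcap_J [set w | cnt w (atom A J) = y J]).
  apply: fin_bigcap_measurable; first exact: finite_finset.
  by move=> J _; apply: measurable_count_eq; [exact: measurable_atom|exact: bounded_atom].
apply/seteqP; split => [w /= <- J _ /=|w /= yw]; first by rewrite ffunE.
by apply/ffunP => J; rewrite ffunE; exact: yw.
Qed.

(** Atoms are disjoint bounded Borel sets, so the defining law applies; [enum_val] numbers the
    subsets because that law is stated for families over an ordinal. *)
Lemma law_atom_counts (a rho k : R) (mu : set (d.-tuple R) -> \bar R) y :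
  gen_waring_process P N a rho k mu ->
  P [set w | atom_counts A w = y] =
  (mgwd_pmf a rho (fun j : 'I_#|{set 'I_n}| => k * fine (mu (atom A (enum_val j))))
    (fun j => y (enum_val j)))%:E.
Proof.
move=> [_ /(_ _ (fun j => atom A (enum_val j)))] <-; last 3 first.
- by move=> j; exact: measurable_atom.
- by move=> j; exact: bounded_atom.
- by move=> i j ij; apply: atom_disjoint; rewrite (inj_eq enum_val_inj).
have cP w J : cnt w (atom A J) = y J <-> N w (atom A J) = (y J)%:R%:E.
  by apply: cnt_eqP; [exact: measurable_atom|exact: bounded_atom].
congr (P _); apply/seteqP; split => w /= yw.
  by move=> j; apply/cP; rewrite -yw ffunE.
by apply/ffunP => J; rewrite ffunE; apply/cP; rewrite -(enum_rankK J); exact: yw.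
Qed.

Lemma moment_le_power : (moment P N A <= \int[P]_w ((cnt w (\bigcup_i A i))%:R ^+ n)%:E)%E.
Proof.
have mU : measurable (\bigcup_i A i).
  by apply: fin_bigcup_measurable => [|i _]; [exact: finite_finset|exact: mA].
apply: ge0_le_integral => //.
- by move=> w _; rewrite lee_fin prodr_ge0// => i _; rewrite fine_ge0.
- apply/measurable_EFinP/measurable_prod => i _.
  exact: measurableT_comp (fine_measurable measurableT) (ppN.2 _ (mA i) (bA i)).
- apply: (@measurable_fibers _ _ _ (fun w => cnt w (\bigcup_i A i)) (fun m => (m%:R ^+ n)%:E)).
  by move=> m; apply: measurable_count_eq => //; exact: bounded_bigcup.
move=> w _; rewrite lee_fin -[n in _ ^+ n]card_ord -prodr_const ler_prod// => i _.
rewrite fine_ge0//= -lee_fin -cntE//; last exact: bounded_bigcup.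
rewrite fineK; last by rewrite cntE.
by rewrite le_measure ?inE//; exact: bigcup_sup.
Qed.

End bounded_borel_family.

(** The law of the atom counts depends on the sets only through the masses of the atoms. *)
Lemma moment_eq_of_atoms n (A A' : 'I_n -> set (d.-tuple R)) (a rho k : R)
    (mu : set (d.-tuple R) -> \bar R) :
  gen_waring_process P N a rho k mu ->
  (forall i, measurable (A i)) -> (forall i, bounded_rd (A i)) ->
  (forall i, measurable (A' i)) -> (forall i, bounded_rd (A' i)) ->
  (forall J, mu (atom A J) = mu (atom A' J)) ->
  moment P N A = moment P N A'.
Proof.
move=> gwN mA bA mA' bA' muAA'; rewrite !moment_atoms//.
apply: (@ge0_integral_eq_law _ _ _ P _ (atom_counts A) (atom_counts A')
  (fun y => (atom_product y)%:E)).
- by move=> y; rewrite lee_fin prodr_ge0// => i _; rewrite sumr_ge0.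
- by move=> y; exact: measurable_atom_counts.
- by move=> y; exact: measurable_atom_counts.
- move=> y; apply: etrans (law_atom_counts mA bA y gwN) _.
  apply: etrans (esym (law_atom_counts mA' bA' y gwN)).
  by under eq_fun do rewrite muAA'.
Qed.

(** Summing over the values of the count gives the series bounded by [rising_moment_bounded]. *)
Lemma power_moment_finite n A (a rho k : R) (mu : set (d.-tuple R) -> \bar R) :
  0 < a -> n%:R < rho -> 0 <= k -> (0 <= mu A)%E ->
  gen_waring_process P N a rho k mu -> measurable A -> bounded_rd A ->
  (\int[P]_w ((cnt w A)%:R ^+ n)%:E < +oo)%E.
Proof.
move=> a0 nrho k0 mu0 gwN mA bA; set K := k * fine (mu A).
have K0 : 0 <= K by rewrite mulr_ge0// fine_ge0.
have law m : P [set w | cnt w A = m] = (waring_pmf a rho K m)%:E.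
  rewrite -(gwN.2 1%N (fun=> A) (fun=> mA) (fun=> bA) _ (fun=> m)); last first.
    by move=> i j; rewrite !ord1 eqxx.
  congr (P _); apply/seteqP; split => w /=; first by move=> /cnt_eqP Nm _; exact: Nm.
  by move=> /(_ ord0) Nm; exact/cnt_eqP.
(* Nonnegativity is read off from the probabilities, without studying the sign of [Gamma]. *)
have p0 m : 0 <= waring_pmf a rho K m by rewrite -lee_fin -law.
have rho0 : 0 < rho by exact: le_lt_trans nrho.
have [B sumB] := rising_moment_bounded a0 K0 nrho p0 (fun m => waring_pmfS m a0 rho0 K0).
rewrite (@ge0_integral_fibers _ _ _ P (fun w => cnt w A) (fun m => (m%:R ^+ n)%:E)); last 2 first.
- by move=> m; rewrite lee_fin exprn_ge0.
- by move=> m; exact: measurable_count_eq.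
apply: (@le_lt_trans _ _ B%:E); last exact: ltry.
apply: lime_le.
  by apply: is_cvg_nneseries => m _ _; rewrite mule_ge0// lee_fin exprn_ge0.
apply: nearW => M; rewrite big_mkord.
rewrite (eq_bigr (fun m : 'I_M => (m%:R ^+ n * waring_pmf a rho K m)%:E)); last first.
  by move=> m _; rewrite EFinM -law.
rewrite sumEFin lee_fin; exact: sumB.
Qed.

End waring_process.

Unset Implicit Arguments.

Theorem theorem9 (R : realType) (dT : measure_display) (T : measurableType dT)
    (P : probability T R) (d n : nat)
    (N : T -> {measure set (d.-tuple R) -> \bar R})
    (a rho : R) (k : nat) :
  (1 <= n)%N -> 0 < a -> n%:R < rho -> (0 < k)%N ->
  gen_waring_process P N a rho k%:R (@lebesgue_d R d) ->
  forall A : 'I_n -> set (d.-tuple R),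
    (forall i, measurable (A i)) -> (forall i, bounded_rd (A i)) ->
    (moment P N A < +oo)%E /\
    forall u : d.-tuple R,
      moment P N (fun i => translate (A i) u) = moment P N A.
Proof.
move=> _ a0 nrho _ gwN A mA bA; have ppN := gwN.1.
have mU : measurable (\bigcup_i A i).
  by apply: fin_bigcup_measurable => [|i _]; [exact: finite_finset|exact: mA].
split=> [|u].
  apply: le_lt_trans (moment_le_power ppN mA bA) _.
  apply: power_moment_finite nrho _ _ gwN mU _ => //; first exact: lebesgue_d_ge0.
  exact: bounded_bigcup.
apply: (moment_eq_of_atoms ppN gwN) => // [i|i|J].
- exact: measurable_translate.
- exact: bounded_translate.
- by rewrite atom_translate lebesgue_d_translate.
Qed.
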